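(* Let $K$ be a finite field with $q$ elements, let $s\geq 1$, let $w_1,\dots,w_s$ be positive integers with $\gcd(w_1,\dots,w_s)=1$, and put $\mathbf{w}=(w_1,\dots,w_s)$. Let $I_{\mathbb{T}}\subset K[t_1,\dots,t_s]$ be the vanishing ideal of the weighted projective torus $\mathbb{T}(w_1,\dots,w_s)$. Let $\mathcal{L}^\flat=\mathbf{w}^\perp\cap\mathbb{Z}^s$ and let $I_{\mathcal{L}^\flat}\subset K[t_1,\dots,t_s]$ be the corresponding lattice ideal. Suppose that $I_{\mathcal{L}^\flat}=(t^{\mathbf{a}_1}-t^{\mathbf{b}_1},\dots,t^{\mathbf{a}_r}-t^{\mathbf{b}_r})$ for some $\mathbf{a}_i,\mathbf{b}_i\in\mathbb{N}^s$. Then $$I_{\mathbb{T}}=\bigl(t^{(q-1)\mathbf{a}_1}-t^{(q-1)\mathbf{b}_1},\dots,t^{(q-1)\mathbf{a}_r}-t^{(q-1)\mathbf{b}_r}\bigr).$$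
   Context: $\mathbb{N}=\{0,1,2,\dots\}$. The weighted projective space $\mathbb{P}(w_1,\dots,w_s)$ is the quotient $(K^s\setminus 0)/K^*$, where $\lambda\in K^*$ acts by $\lambda(x_1,\dots,x_s)=(\lambda^{w_1}x_1,\dots,\lambda^{w_s}x_s)$. The weighted projective torus is $\mathbb{T}(w_1,\dots,w_s)=\{(x_1,\dots,x_s)\in\mathbb{P}(w_1,\dots,w_s): x_1\cdots x_s\neq 0\}$. The polynomial ring $K[t_1,\dots,t_s]$ is graded by $\deg(t_i)=w_i$. The vanishing ideal of a set $X\subset\mathbb{P}(w_1,\dots,w_s)$ is the ideal of $K[t_1,\dots,t_s]$ generated by all homogeneous polynomials (for this grading) that vanish on $X$. $\mathbf{w}^\perp$ is the orthogonal of $\langle\mathbf{w}\rangle$ in $\mathbb{R}^s$ with respect to the canonical inner product. For $\mathbf{a}=(a_1,\dots,a_s)\in\mathbb{N}^s$, $t^{\mathbf{a}}=t_1^{a_1}\cdots t_s^{a_s}$. For a lattice $\mathcal{L}\subset\mathbb{Z}^s$ (a subgroup), the lattice ideal $I_{\mathcal{L}}\subset K[t_1,\dots,t_s]$ is the ideal generated by $t^{\mathbf{a}}-t^{\mathbf{b}}$ for all $\mathbf{a},\mathbf{b}\in\mathbb{N}^s$ with $\mathbf{a}-\mathbf{b}\in\mathcal{L}$. *)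

(* Defs.v *)
From HB Require Import structures.
From mathcomp Require Import all_boot all_order all_algebra all_fingroup.
From mathcomp Require Import reals.
From mathcomp Require Import mpoly.

Set Implicit Arguments.
Unset Strict Implicit.
Unset Printing Implicit Defensive.

Import GRing.Theory.
Local Open Scope ring_scope.

Definition ideal_gen (A : comNzRingType) (S : A -> Prop) (f : A) : Prop :=
  exists (n : nat) (c g : 'I_n -> A),
    (forall i, S (g i)) /\ f = \sum_(i < n) c i * g i.

Section WeightedProjective.
Variables (s : nat) (w : 'I_s -> nat).

Definition wdeg (m : 'X_{1..s}) : nat := (\sum_(i < s) m i * w i)%N.

Fact wdeg0 : wdeg 0%MM = 0%N.
Proof. by rewrite /wdeg big1 // => i _; rewrite mnm0E mul0n. Qed.

Fact wdegD : {morph wdeg : m1 m2 / (m1 + m2)%MM >-> (m1 + m2)%N}.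
Proof.
move=> m1 m2; rewrite /wdeg -big_split /=.
by apply: eq_bigr => i _; rewrite mnmDE mulnDl.
Qed.

HB.instance Definition _ := isMeasure.Build s wdeg wdeg0 wdegD.

Variable K : finFieldType.

Definition wscale (x : {ffun 'I_s -> K}) (l : {unit K}) : {ffun 'I_s -> K} :=
  [ffun i => val l ^+ w i * x i].

Fact wscale_is_action : is_action [set: {unit K}] wscale.
Proof.
apply: is_total_action => [x | x l1 l2].
  by apply/ffunP=> i; rewrite ffunE /= expr1n mul1r.
by apply/ffunP=> i; rewrite !ffunE /= mulrA -exprMn [val l2 * _]mulrC.
Qed.
Canonical wscale_action := Action wscale_is_action.

(* The points of the weighted projective space are the orbits, as subsets of
   K^s, of the nonzero vectors. *)
Definition wproj : {set {set {ffun 'I_s -> K}}} :=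
  [set orbit wscale_action [set: {unit K}] x
     | x : {ffun 'I_s -> K} & x != 0].

Definition wtorus : {set {set {ffun 'I_s -> K}}} :=
  [set p in wproj | [exists x in p, \prod_(i < s) (x : {ffun _}) i != 0]].

(* For f homogeneous with respect to wdeg w, this does not depend on the chosen
   representative x of the point p. *)
Definition vanishes_at (f : {mpoly K[s]}) (p : {set {ffun 'I_s -> K}}) : Prop :=
  forall x : {ffun 'I_s -> K}, x \in p -> f.@[x] = 0.

Definition vanishing_ideal (X : {set {set {ffun 'I_s -> K}}}) :
    {mpoly K[s]} -> Prop :=
  ideal_gen (fun g : {mpoly K[s]} =>
    (exists d : nat, g \is d.-homog for wdeg) /\
    (forall p, p \in X -> vanishes_at g p)).

End WeightedProjective.

Section Lattice.
Variable s : nat.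

Definition orth (R : realType) (u : 'rV[R]_s) (x : 'rV[R]_s) : Prop :=
  forall y : 'rV[R]_s, (y <= u)%MS -> \sum_(i < s) x 0 i * y 0 i = 0.

Definition Lflat (R : realType) (w : 'I_s -> nat) (z : 'rV[int]_s) : Prop :=
  orth (\row_(i < s) (w i)%:R : 'rV[R]_s) (map_mx intr z).

Definition lattice_ideal (K : fieldType) (L : 'rV[int]_s -> Prop) :
    {mpoly K[s]} -> Prop :=
  ideal_gen (fun g : {mpoly K[s]} => exists a b : 'X_{1..s},
    L (\row_(i < s) ((a i)%:Z - (b i)%:Z)) /\ g = 'X_[a] - 'X_[b]).

Definition binomial_ideal (K : fieldType) (r : nat)
    (a b : 'I_r -> 'X_{1..s}) : {mpoly K[s]} -> Prop :=
  ideal_gen (fun g : {mpoly K[s]} => exists i : 'I_r, g = 'X_[a i] - 'X_[b i]).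

End Lattice.

(* Main.v *)
(** Let U be the set of vectors of K^s with nonzero coordinates. Pairing f with
    monomials, the character sums over U show that f vanishes on U only if, for
    every residue class of exponents modulo q - 1, the coefficients of f in that
    class add up to 0. A homogeneous such f is therefore a combination of
    binomials t^m - t^m' with m and m' congruent modulo q - 1 and of equal
    weight. Writing m = (q-1) u + c and m' = (q-1) u' + c, this binomial is t^c
    times the image of t^u - t^u', which lies in the lattice ideal, under the
    substitution t_i |-> t_i^(q-1). *)

Require Import Defs.
From HB Require Import structures.
From mathcomp Require Import all_boot all_order all_algebra all_fingroup.
From mathcomp Require Import cyclic finfield.
From mathcomp Require Import reals.
From mathcomp Require Import mpoly.

Set Implicit Arguments.
Unset Strict Implicit.
Unset Printing Implicit Defensive.

Import GRing.Theory.
Local Open Scope ring_scope.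

(** * Closure properties of generated ideals *)

Section IdealGen.
Variable A : comNzRingType.
Implicit Types (S T : A -> Prop) (f g : A).

Lemma ideal_gen_mem S f : S f -> ideal_gen S f.
Proof.
by move=> Sf; exists 1%N, (fun=> 1), (fun=> f); rewrite big_ord1 mul1r.
Qed.

Lemma ideal_gen0 S : ideal_gen S 0.
Proof.
by exists 0%N, (fun=> 0), (fun=> 0); rewrite big_ord0; split=> // -[].
Qed.

Lemma ideal_genD S f g : ideal_gen S f -> ideal_gen S g -> ideal_gen S (f + g).
Proof.
move=> [m [c1 [g1 [S1 ->]]]] [n [c2 [g2 [S2 ->]]]].
pose glue (u : 'I_m -> A) (v : 'I_n -> A) (i : 'I_(m + n)) :=
  match split i with inl j => u j | inr j => v j end.
have gluel u v i : glue u v (lshift n i) = u i.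
  by rewrite /glue (unsplitK (inl i : 'I_m + 'I_n)).
have gluer u v i : glue u v (rshift m i) = v i.
  by rewrite /glue (unsplitK (inr i : 'I_m + 'I_n)).
exists (m + n)%N, (glue c1 c2), (glue g1 g2); split=> [i|].
  by rewrite /glue; case: (split i).
rewrite big_split_ord /=; congr (_ + _);
  by apply: eq_bigr => i _; rewrite ?gluel ?gluer.
Qed.

Lemma ideal_genMl S h f : ideal_gen S f -> ideal_gen S (h * f).
Proof.
move=> [n [c [g [Sg ->]]]]; exists n, (fun i => h * c i), g; split=> //.
by rewrite mulr_sumr; apply: eq_bigr => i _; rewrite mulrA.
Qed.

Lemma ideal_gen_sum S (I : Type) (r : seq I) (P : pred I) (F : I -> A) :
  (forall i, P i -> ideal_gen S (F i)) ->
  ideal_gen S (\sum_(i <- r | P i) F i).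
Proof.
by move=> SF; apply: big_ind => //; [exact: ideal_gen0 | exact: ideal_genD].
Qed.

Lemma ideal_gen_sub S T f :
  (forall g, S g -> ideal_gen T g) -> ideal_gen S f -> ideal_gen T f.
Proof.
move=> ST [n [c [g [Sg ->]]]].
by apply: ideal_gen_sum => i _; apply/ideal_genMl/ST.
Qed.

End IdealGen.

(** The images of the coefficients serve as coefficients, so [phi] need not be surjective. It is
    applied to the substitution t_i |-> t_i^k. *)
Lemma ideal_gen_rmorph (A B : comNzRingType) (phi : {rmorphism A -> B})
    (S : A -> Prop) (T : B -> Prop) f :
  (forall g, S g -> ideal_gen T (phi g)) ->
  ideal_gen S f -> ideal_gen T (phi f).
Proof.
move=> ST [n [c [g [Sg ->]]]]; rewrite rmorph_sum.
by apply: ideal_gen_sum => i _; rewrite rmorphM; apply/ideal_genMl/ST.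
Qed.

(** * Character sums over a finite field *)

Section FiniteFieldSums.
Variable K : finFieldType.

Lemma predn_card_finField_gt0 : (0 < #|K|.-1)%N.
Proof. by rewrite -subn1 subn_gt0 finNzRing_gt1. Qed.

Lemma expf_predn_card (x : K) : x != 0 -> x ^+ #|K|.-1 = 1.
Proof.
move=> x0; apply: (mulfI x0); rewrite -exprS prednK ?expf_card ?mulr1 //.
by rewrite ltnW // finNzRing_gt1.
Qed.

(** The additive group of [K] has order q, so q is 0 in [K]. *)
Lemma natr_predn_card_finField : #|K|.-1%:R = -1 :> K.
Proof.
apply/eqP; rewrite -subr_eq0 opprK natr1 prednK ?(ltnW (finNzRing_gt1 K)) //.
by rewrite -FinRing.zmodXgE -cardsT expg_cardG // inE.
Qed.

(** Only k modulo q - 1 matters. If q - 1 divides k, the q - 1 terms are all 1; otherwise a change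
    of variable multiplies the sum by a factor other than 1. *)
Lemma sum_expf_neq0 k :
  \sum_(y : K | y != 0) y ^+ k = if (#|K|.-1 %| k)%N then -1 else 0.
Proof.
have n0 := predn_card_finField_gt0.
rewrite {1}(divn_eq k #|K|.-1); case: ifPn => [/eqP->|kn].
  rewrite (eq_bigr (fun=> 1)) => [|y y0]; last first.
    by rewrite addn0 mulnC exprM expf_predn_card // expr1n.
  by rewrite sumr_const -natr_predn_card_finField cardC1.
have [j [j0 jn ->]] : exists j, [/\ (0 < j)%N, (j < #|K|.-1)%N & (k %% #|K|.-1)%N = j].
  by exists (k %% #|K|.-1)%N; rewrite lt0n kn ltn_mod.
(* X^j - 1 has at most j < q - 1 roots, so some nonzero element is not a root. *)
have [y0 y0n0 y0j] : exists2 y0 : K, y0 != 0 & y0 ^+ j != 1.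
  apply/exists_inP; apply: contraLR jn => /exists_inPn noy; rewrite -leqNgt.
  have p0 : 'X^j - 1 != 0 :> {poly K}.
    by rewrite -size_poly_gt0 size_XnsubC.
  have := max_poly_roots p0 _ (enum_uniq [pred y : K | y != 0]).
  rewrite size_XnsubC // ltnS -cardE cardC1; apply.
  apply/allP=> y; rewrite mem_enum => /noy; rewrite negbK => /eqP yj.
  by rewrite /root !hornerE yj subrr.
rewrite (eq_bigr (fun y => y ^+ j)) => [|y yn0]; last first.
  by rewrite exprD mulnC exprM expf_predn_card // expr1n mul1r.
(* Replacing y by y0 y shows that the sum equals y0^j times itself; a nonzero sum could be
   cancelled, giving y0^j = 1. *)
apply: contraNeq y0j => sum0; apply/eqP/(mulIf sum0).
rewrite mul1r mulr_sumr [RHS](reindex_inj (mulfI y0n0)).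
by apply: eq_big => y; rewrite ?mulf_eq0 ?negb_or ?y0n0 // exprMn.
Qed.

Variable s : nat.

(** By distributivity the sum factors into one-variable sums, each equal to -1 or 0. *)
Lemma sum_prod_expf (e : 'I_s -> nat) :
  \sum_(x : {ffun 'I_s -> K} | x \in ffun_on [pred y | y != 0])
      \prod_(i < s) x i ^+ e i =
  if [forall i, (#|K|.-1 %| e i)%N] then (-1) ^+ s else 0.
Proof.
rewrite -(bigA_distr_big [pred y : K | y != 0] (fun i y => y ^+ e i)).
under eq_bigr do rewrite sum_expf_neq0.
case: ifPn => [/forallP edvd|/forallPn[i /negPf ei]].
  by under eq_bigr do rewrite edvd; rewrite prodr_const card_ord.
by rewrite (bigD1 i) //= ei mul0r.
Qed.

(* Orthogonality: sum the values f(x) x^((q-2)k), where x^((q-2)k) = x^(-k). *)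
Lemma sum_mcoeff_congr (f : {mpoly K[s]}) (k : 'X_{1..s}) :
  (forall x : {ffun 'I_s -> K}, (forall i, x i != 0) -> f.@[x] = 0) ->
  \sum_(m <- msupp f | [forall i, m i == k i %[mod #|K|.-1]]) f@_m = 0.
Proof.
move=> f0; have n0 := predn_card_finField_gt0.
pose e (m : 'X_{1..s}) i := (m i + #|K|.-2 * k i)%N.
have eE m i : (#|K|.-1 %| e m i)%N = (m i == k i %[mod #|K|.-1]).
  (* Adding (q - 2) k_i to both sides turns k_i into (q - 1) k_i, which is 0 modulo q - 1. *)
  rewrite -(eqn_modDr (#|K|.-2 * k i)) -mulSn prednK //.
  by rewrite [X in _ == X]modnMr.
have : \sum_(x : {ffun 'I_s -> K} | x \in ffun_on [pred y | y != 0])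
    f.@[x] * \prod_(i < s) x i ^+ (#|K|.-2 * k i) = 0.
  by apply: big1 => x /ffun_onP xn0; rewrite f0 ?mul0r.
under eq_bigr => x _.
  rewrite mevalE mulr_suml; under eq_bigr => m _.
    rewrite -mulrA -big_split /=; under eq_bigr do rewrite -exprD.
    over.
  over.
rewrite exchange_big /=; under eq_bigr => m _.
  rewrite -mulr_sumr (sum_prod_expf (e m)); under eq_forallb do rewrite eE.
  rewrite -[_ * _]mulr1 -mulrA (fun_if (fun z => z * 1)) mulr1 mul0r.
  rewrite (fun_if (fun z => f@_m * z)) mulr0.
  over.
(* What remains is the sum over the class of [k] times the nonzero sign (-1)^s. *)
rewrite -big_mkcond /= -mulr_suml => /eqP.
by rewrite mulf_eq0 signr_eq0 orbF => /eqP.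
Qed.

End FiniteFieldSums.

(** * Weights, the lattice ideal and the points of the torus *)

Section Weights.
Variables (s : nat) (w : 'I_s -> nat).

(** The inner product of u - v with w is the difference of the weights, and natural numbers embed
    injectively in [R]. *)
Lemma Lflat_row (R : realType) (u v : 'X_{1..s}) :
  Lflat R w (\row_(i < s) ((u i)%:Z - (v i)%:Z)) <-> wdeg w u = wdeg w v.
Proof.
have dotE : \sum_(i < s) map_mx intr (\row_(i < s) ((u i)%:Z - (v i)%:Z)) 0 i
    * (\row_(i < s) (w i)%:R : 'rV[R]_s) 0 i = (wdeg w u)%:R - (wdeg w v)%:R.
  rewrite /wdeg !natr_sum -sumrB; apply: eq_bigr => i _.
  by rewrite !mxE rmorphB /= !natrM mulrBl.
split=> [/(_ _ (submx_refl _)) | uv y /sub_rVP[c ->]].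
  by rewrite dotE => /eqP; rewrite subr_eq0 Num.Theory.eqr_nat => /eqP.
transitivity (c * ((wdeg w u)%:R - (wdeg w v)%:R)); last first.
  by rewrite uv subrr mulr0.
by rewrite -dotE mulr_sumr; apply: eq_bigr => i _; rewrite !mxE mulrCA.
Qed.

(* The substitution t_i |-> X^(w_i) kills the lattice ideal. *)
Lemma lattice_ideal_wdeg (R : realType) (K : fieldType) (u v : 'X_{1..s}) :
  lattice_ideal (Lflat R w) ('X_[u] - 'X_[v] : {mpoly K[s]}) ->
  wdeg w u = wdeg w v.
Proof.
pose phi : {rmorphism {mpoly K[s]} -> {poly K}} :=
  mmap (@polyC K) (fun i => 'X^(w i)).
have phiX m : phi 'X_[m] = 'X^(wdeg w m).
  rewrite /phi /= mmapX /mmap1 /wdeg -prodrXr.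
  by apply: eq_bigr => i _; rewrite -exprM mulnC.
move=> [n [c [g [Sg E]]]].
have /eqP : phi ('X_[u] - 'X_[v]) = 0.
  rewrite E rmorph_sum big1 // => i _.
  have [a [b [/Lflat_row ab ->]]] := Sg i.
  by rewrite rmorphM rmorphB !phiX ab subrr mulr0.
rewrite rmorphB !phiX subr_eq0 => /eqP /(congr1 (fun p : {poly K} => size p)).
by rewrite !size_polyXn => -[].
Qed.

(** Scaling by units preserves nonzero coordinates, so the orbits in the torus together make up
    exactly the vectors with no zero coordinate. *)
Lemma vanishes_at_wtorus (K : finFieldType) (g : {mpoly K[s]}) :
  (0 < s)%N ->
  (forall p, p \in wtorus w K -> vanishes_at g p) <->
  (forall x : {ffun 'I_s -> K}, (forall i, x i != 0) -> g.@[x] = 0).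
Proof.
move=> s0; split=> [g0 x xn0 | g0 p].
  apply: (g0 (orbit (wscale_action w K) setT x)); last exact: orbit_refl.
  rewrite inE imset_f /=.
    apply/exists_inP; exists x; first exact: orbit_refl.
    by apply/prodf_neq0 => i _.
  (* A first coordinate exists because s > 0, and it shows that [x] is not the zero vector. *)
  rewrite inE; apply: contraNneq (xn0 (Ordinal s0)) => ->.
  by rewrite ffunE.
rewrite inE => /andP[/imsetP[z _ ->]] /exists_inP[x /orbitP[l _ <-]].
move=> /prodf_neq0 xn0 y /orbitP[l' _ <-]; apply: g0 => i.
have := xn0 i isT; rewrite /= !ffunE !mulf_eq0 !negb_or => /andP[_ ->].
by rewrite andbT expf_neq0 // -unitfE (valP l').
Qed.

End Weights.

(** * Substituting powers of the variables, and congruent exponents *)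

Lemma comp_mpolyX_expn (R : comNzRingType) (s k : nat) (m : 'X_{1..s}) :
  'X_[m] \mPo [tuple 'X_i ^+ k | i < s] = 'X_[m *+ k] :> {mpoly R[s]}.
Proof.
rewrite comp_mpolyX [RHS]mpolyXE_id; apply: eq_bigr => i _.
by rewrite tnth_mktuple -exprM mulmnE mulnC.
Qed.

Section Powers.
Variables (s : nat) (w : 'I_s -> nat) (K : finFieldType).
Variables (r : nat) (a b : 'I_r -> 'X_{1..s}).
Let n := #|K|.-1.

Lemma binomial_ideal_mulmn (k : nat) (f : {mpoly K[s]}) :
  binomial_ideal a b f ->
  binomial_ideal (fun i => (a i *+ k)%MM) (fun i => (b i *+ k)%MM)
    (f \mPo [tuple 'X_i ^+ k | i < s]).
Proof.
apply: (@ideal_gen_rmorph _ _ (comp_mpoly [tuple 'X_i ^+ k | i < s])) => _ [i ->].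
by apply: ideal_gen_mem; exists i; rewrite rmorphB /= !comp_mpolyX_expn.
Qed.

Lemma binomial_ideal_congr (m m' : 'X_{1..s}) :
  (forall u v, wdeg w u = wdeg w v ->
     binomial_ideal a b ('X_[u] - 'X_[v] : {mpoly K[s]})) ->
  wdeg w m = wdeg w m' ->
  (forall i, m i = m' i %[mod n]) ->
  binomial_ideal (fun i => (a i *+ n)%MM) (fun i => (b i *+ n)%MM)
    ('X_[m] - 'X_[m'] : {mpoly K[s]}).
Proof.
move=> abX wm cm; have n0 : (0 < n)%N := predn_card_finField_gt0 K.
pose quo (m : 'X_{1..s}) : 'X_{1..s} := [multinom (m i %/ n)%N | i < s].
pose rem (m : 'X_{1..s}) : 'X_{1..s} := [multinom (m i %% n)%N | i < s].
have qrE l : l = (rem l + quo l *+ n)%MM.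
  by apply/mnmP=> i; rewrite mnmDE mulmnE !mnmE addnC -divn_eq.
have remE : rem m' = rem m by apply/mnmP=> i; rewrite !mnmE cm.
(* The weight of an exponent is that of its remainder plus n times that of its quotient; the common
   remainder and the factor n > 0 cancel. *)
have wquo : wdeg w (quo m) = wdeg w (quo m').
  have wdegMn l : wdeg w (l *+ n)%MM = (wdeg w l * n)%N.
    rewrite /wdeg big_distrl; apply: eq_bigr => i _.
    by rewrite mulmnE mulnAC.
  apply/eqP; rewrite -(eqn_pmul2r n0) -!wdegMn -(eqn_add2l (wdeg w (rem m))).
  by rewrite -{2}remE -!wdegD -!qrE wm.
rewrite (qrE m) (qrE m') remE !mpolyXD -mulrBr -!comp_mpolyX_expn -rmorphB.
exact/ideal_genMl/binomial_ideal_mulmn/abX.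
Qed.

Lemma homog_vanishing_binomial_ideal (d : nat) (f : {mpoly K[s]}) :
  (forall u v, wdeg w u = wdeg w v ->
     binomial_ideal a b ('X_[u] - 'X_[v] : {mpoly K[s]})) ->
  f \is d.-homog for (wdeg w) ->
  (forall x : {ffun 'I_s -> K}, (forall i, x i != 0) -> f.@[x] = 0) ->
  binomial_ideal (fun i => (a i *+ n)%MM) (fun i => (b i *+ n)%MM) f.
Proof.
move=> abX /dhomogP fd f0; have n0 : (0 < n)%N := predn_card_finField_gt0 K.
pose cls (m : 'X_{1..s}) : {ffun 'I_s -> 'I_n} :=
  [ffun i => Ordinal (ltn_pmod (m i) n0)].
have clsE m m' : (cls m == cls m') = [forall i, m i == m' i %[mod n]].
  apply/eqP/forallP => [/ffunP mm' i|mm'].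
    by have /(congr1 val)/= := mm' i; rewrite !ffunE /= => ->.
  by apply/ffunP=> i; apply/val_inj; rewrite !ffunE /=; apply/eqP.
rewrite [f]mpolyE (partition_big cls predT) //=.
apply: ideal_gen_sum => c _.
have [/hasP[m0 m0f /eqP<-]|noc] := boolP (has (fun m => cls m == c) (msupp f));
  last first.
  by rewrite big_hasC //; exact: ideal_gen0.
(* The coefficients in the class of [m0] add up to 0, so subtracting the monomial of [m0] from each
   term changes nothing. *)
have -> : \sum_(m <- msupp f | cls m == cls m0) f@_m *: 'X_[m] =
    \sum_(m <- msupp f | cls m == cls m0) f@_m *: ('X_[m] - 'X_[m0]).
  under [RHS]eq_bigr do rewrite scalerBr.
  rewrite sumrB -scaler_suml; under [X in X *: _]eq_bigl do rewrite clsE.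
  by rewrite sum_mcoeff_congr // scale0r subr0.
rewrite big_seq_cond; apply: ideal_gen_sum => m /andP[mf].
rewrite clsE => /forallP mm0.
rewrite -mul_mpolyC; apply/ideal_genMl/binomial_ideal_congr => //.
  (* Homogeneity gives [m] and [m0] the same weight d. *)
  by rewrite !fd.
by move=> i; apply/eqP.
Qed.

End Powers.

Theorem lemma2p11 (R : realType) (K : finFieldType) (q : nat) (hq : #|K| = q)
    (s : nat) (hs : (1 <= s)%N) (w : 'I_s -> nat)
    (hw : forall i, (0 < w i)%N) (hgcd : \big[gcdn/0%N]_(i < s) w i = 1%N)
    (r : nat) (a b : 'I_r -> 'X_{1..s})
    (hab : forall f : {mpoly K[s]},
       lattice_ideal (Lflat R w) f <-> binomial_ideal a b f) :
  forall f : {mpoly K[s]},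
    vanishing_ideal w (wtorus w K) f <->
    binomial_ideal (fun i => (a i *+ (q - 1))%MM) (fun i => (b i *+ (q - 1))%MM) f.
Proof.
(* Each inclusion is checked on generators. *)
move=> f; rewrite -hq subn1; split; apply: ideal_gen_sub => g.
  move=> [[d gd] /(vanishes_at_wtorus w g hs) g0].
  apply: homog_vanishing_binomial_ideal gd g0 => u v /(Lflat_row w R) uv.
  by apply/hab/ideal_gen_mem; exists u, v.
move=> [i ->]; apply: ideal_gen_mem; split.
  (* Homogeneity of the binomial: its two exponents have equal weight because each given binomial
     lies in the lattice ideal. *)
  have wab : wdeg w (a i) = wdeg w (b i).
    by apply/(@lattice_ideal_wdeg _ _ R K)/hab/ideal_gen_mem; exists i.
  exists (wdeg w (a i *+ #|K|.-1)%MM); apply: rpredB; rewrite dhomogX //=.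
  rewrite /wdeg; under eq_bigr do rewrite mulmnE mulnAC.
  under [X in _ == X]eq_bigr do rewrite mulmnE mulnAC.
  by rewrite -!big_distrl /= -/(wdeg w (a i)) -/(wdeg w (b i)) wab.
apply/vanishes_at_wtorus => // x xn0.
(* Both monomials take the value 1 at [x], since y^(q-1) = 1 for nonzero y. *)
have x1 (m : 'X_{1..s}) : \prod_(i < s) x i ^+ (m *+ #|K|.-1)%MM i = 1.
  apply: big1 => j _; rewrite mulmnE mulnC exprM.
  by rewrite expf_predn_card ?expr1n.
by rewrite mevalB !mevalX !x1 subrr.
Qed.
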